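(* Given an endofunctor (resp. a comonad) $G$ in a category $\mathcal M$, the category $\mathfrak{distr}(\mathcal M,G)$ is canonically isomorphic to the category of Eilenberg–Moore categories $\mathcal M^{\mathbf T}$ of varying monads $\mathbf T$ on $\mathcal M$ equipped with a lift of the endofunctor (resp. comonad) $G$, and functors commuting with the forgetful functors and intertwining the lifts of $G$.
   Context: For a monad $\mathbf T=(T,\mu,\eta)$ on $\mathcal M$, a distributive law from an endofunctor $G$ to $\mathbf T$ is a natural transformation $l:TG\Rightarrow GT$ with $l\circ\mu G=G\mu\circ lT\circ Tl$ and $l\circ\eta G=G\eta$. If $G=(G,\delta,\varepsilon)$ is a comonad one requires in addition $\delta T\circ l=Gl\circ lG\circ T\delta$ and $\varepsilon T\circ l=T\varepsilon$. $\mathfrak{distr}(\mathcal M,G)$ is the category whose objects are pairs $(\mathbf T,l)$ with $\mathbf T$ a monad on $\mathcal M$ and $l$ a distributive law from $G$ to $\mathbf T$, and whose morphisms $(\mathbf T,l)\to(\mathbf T',l')$ are the monad morphisms $\alpha:\mathbf T\to\mathbf T'$ (natural transformations $\alpha:T\Rightarrow T'$ with $\alpha\circ\mu=\mu'\circ\alpha T'\circ T\alpha$ and $\alpha\circ\eta=\eta'$) such that $l'\circ\alpha G=G\alpha\circ l$. $\mathcal M^{\mathbf T}$ is the Eilenberg–Moore category of $\mathbf T$-modules $(M,\nu:TM\to M)$ with forgetful functor $U:\mathcal M^{\mathbf T}\to\mathcal M$, $U(M,\nu)=M$; $U'$ is the forgetful functor of $\mathcal M^{\mathbf T'}$. A lift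 of an endofunctor $G$ to $\mathcal M^{\mathbf T}$ is an endofunctor $\tilde G$ of $\mathcal M^{\mathbf T}$ with $U\tilde G=GU$; a lift of a comonad is a comonad $(\tilde G,\tilde\delta,\tilde\varepsilon)$ with $U\tilde G=GU$, $U\tilde\delta=\delta U$, $U\tilde\varepsilon=\varepsilon U$. A functor $H:\mathcal M^{\mathbf T'}\to\mathcal M^{\mathbf T}$ commutes with the forgetful functors if $UH=U'$, and intertwines the lifts $\tilde G'$ on $\mathcal M^{\mathbf T'}$ and $\tilde G$ on $\mathcal M^{\mathbf T}$ if $H\tilde G'=\tilde GH$. *)

(* Defs.v *)
(* All equations between objects, morphisms and functors are Leibniz
   equalities.  Proof irrelevance and functional extensionality are used to
   prove them for morphisms with proof components. *)
From Stdlib Require Import ProofIrrelevance FunctionalExtensionality.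
From Stdlib Require Import Program.Tactics.

Set Implicit Arguments.
Unset Strict Implicit.
Unset Printing Implicit Defensive.

Declare Scope cat_scope.
Delimit Scope cat_scope with cat.
Open Scope cat_scope.

Record Category : Type := {
  Obj :> Type;
  Hom : Obj -> Obj -> Type;
  idm : forall X, Hom X X;
  comp : forall X Y Z, Hom Y Z -> Hom X Y -> Hom X Z;
  comp_id_l : forall X Y (f : Hom X Y), comp (idm Y) f = f;
  comp_id_r : forall X Y (f : Hom X Y), comp f (idm X) = f;
  comp_assoc : forall W X Y Z (h : Hom Y Z) (g : Hom X Y) (f : Hom W X),
    comp h (comp g f) = comp (comp h g) f
}.
Arguments Hom {_} _ _.
Arguments idm {_} _.
Arguments comp {_ _ _ _} _ _.

Notation "g ∘ f" := (comp g f) (at level 40, left associativity) : cat_scope.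

(* Equality of morphisms whose sources and targets are not known to be
   convertible: [f] and [f'] have the same source, the same target, and are
   equal. *)
Inductive hom_eq (C : Category) (X Y : C) (f : Hom X Y) :
    forall X' Y' : C, Hom X' Y' -> Prop :=
  hom_eq_refl : hom_eq f f.

Program Definition op (C : Category) : Category := {|
  Obj := Obj C;
  Hom := fun X Y => @Hom C Y X;
  idm := fun X => @idm C X;
  comp := fun X Y Z g f => @comp C Z Y X f g
|}.
Next Obligation. apply comp_id_r. Qed.
Next Obligation. apply comp_id_l. Qed.
Next Obligation. symmetry; apply comp_assoc. Qed.

(* Objects [O], with morphisms those of [C] between the images under [p]. *)
Program Definition Induced (C : Category) (O : Type) (p : O -> C) :
    Category := {|
  Obj := O;
  Hom := fun X Y => Hom (p X) (p Y);
  idm := fun X => idm (p X);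
  comp := fun X Y Z g f => g ∘ f
|}.
Next Obligation. apply comp_id_l. Qed.
Next Obligation. apply comp_id_r. Qed.
Next Obligation. apply comp_assoc. Qed.

Record Functor (C D : Category) : Type := {
  fobj :> C -> D;
  fmap : forall X Y : C, Hom X Y -> Hom (fobj X) (fobj Y);
  fmap_id : forall X : C, fmap (idm X) = idm (fobj X);
  fmap_comp : forall (X Y Z : C) (g : Hom Y Z) (f : Hom X Y),
    fmap (g ∘ f) = fmap g ∘ fmap f
}.
Arguments fmap {_ _} _ {_ _} _.

Program Definition IdF (C : Category) : Functor C C := {|
  fobj := fun X => X;
  fmap := fun X Y f => f
|}.

Program Definition CompF (C D E : Category) (G : Functor D E) (F : Functor C D) :
    Functor C E := {|
  fobj := fun X => G (F X);
  fmap := fun X Y f => fmap G (fmap F f)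
|}.
Next Obligation. rewrite !fmap_id; reflexivity. Qed.
Next Obligation. rewrite !fmap_comp; reflexivity. Qed.

Notation "G ∙ F" := (CompF G F) (at level 40, left associativity) : cat_scope.

Definition is_isomorphism_of_categories (C D : Category) (F : Functor C D) :
    Prop :=
  exists K : Functor D C, K ∙ F = IdF C /\ F ∙ K = IdF D.

Lemma functor_irrelevance (C D : Category) (o : C -> D)
    (m : forall X Y : C, Hom X Y -> Hom (o X) (o Y)) p p' q q' :
  @Build_Functor C D o m p q = @Build_Functor C D o m p' q'.
Proof.
  rewrite (proof_irrelevance _ p p'), (proof_irrelevance _ q q'); reflexivity.
Qed.

Lemma CompF_assoc (B C D E : Category) (H : Functor D E) (G : Functor C D)
    (F : Functor B C) : H ∙ (G ∙ F) = H ∙ G ∙ F.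
Proof. apply functor_irrelevance. Qed.

Lemma CompF_id_l (C D : Category) (F : Functor C D) : IdF D ∙ F = F.
Proof. destruct F; apply functor_irrelevance. Qed.

Lemma CompF_id_r (C D : Category) (F : Functor C D) : F ∙ IdF C = F.
Proof. destruct F; apply functor_irrelevance. Qed.

Record NatTrans (C D : Category) (F G : Functor C D) : Type := {
  component :> forall X : C, Hom (F X) (G X);
  naturality : forall (X Y : C) (f : Hom X Y),
    component Y ∘ fmap F f = fmap G f ∘ component X
}.

Record Monad (M : Category) : Type := {
  monad_functor :> Functor M M;
  mu : NatTrans (monad_functor ∙ monad_functor) monad_functor;
  eta : NatTrans (IdF M) monad_functor;
  mu_assoc : forall X, mu X ∘ fmap monad_functor (mu X)
                       = mu X ∘ mu (monad_functor X);
  mu_eta_l : forall X, mu X ∘ eta (monad_functor X) = idm (monad_functor X);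
  mu_eta_r : forall X, mu X ∘ fmap monad_functor (eta X)
                       = idm (monad_functor X)
}.
Arguments mu {_} _.
Arguments eta {_} _.

Record Comonad (M : Category) : Type := {
  comonad_functor :> Functor M M;
  delta : NatTrans comonad_functor (comonad_functor ∙ comonad_functor);
  epsilon : NatTrans comonad_functor (IdF M);
  delta_coassoc : forall X, fmap comonad_functor (delta X) ∘ delta X
                            = delta (comonad_functor X) ∘ delta X;
  delta_epsilon_l : forall X, epsilon (comonad_functor X) ∘ delta X
                              = idm (comonad_functor X);
  delta_epsilon_r : forall X, fmap comonad_functor (epsilon X) ∘ delta X
                              = idm (comonad_functor X)
}.
Arguments delta {_} _.
Arguments epsilon {_} _.

Record TModule (M : Category) (T : Monad M) : Type := {
  carrier :> M;
  action : Hom (T carrier) carrier;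
  action_mu : action ∘ mu T carrier = action ∘ fmap T action;
  action_eta : action ∘ eta T carrier = idm carrier
}.
Arguments action {_ _} _.

Record ModuleHom (M : Category) (T : Monad M) (X Y : TModule T) : Type := {
  module_hom :> Hom (carrier X) (carrier Y);
  module_hom_action : module_hom ∘ action X = action Y ∘ fmap T module_hom
}.

Lemma ModuleHom_ext (M : Category) (T : Monad M) (X Y : TModule T)
    (f g : ModuleHom X Y) : module_hom f = module_hom g -> f = g.
Proof.
  destruct f as [f pf], g as [g pg]; simpl; intros <-.
  rewrite (proof_irrelevance _ pf pg); reflexivity.
Qed.

Program Definition EM (M : Category) (T : Monad M) : Category := {|
  Obj := TModule T;
  Hom := @ModuleHom M T;
  idm := fun X => {| module_hom := idm (carrier X) |};
  comp := fun X Y Z g f => {| module_hom := module_hom g ∘ module_hom f |}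
|}.
Next Obligation. rewrite fmap_id, comp_id_l, comp_id_r; reflexivity. Qed.
Next Obligation.
  rewrite <- comp_assoc, module_hom_action, comp_assoc, module_hom_action.
  rewrite <- comp_assoc, fmap_comp; reflexivity.
Qed.
Next Obligation. apply ModuleHom_ext, comp_id_l. Qed.
Next Obligation. apply ModuleHom_ext, comp_id_r. Qed.
Next Obligation. apply ModuleHom_ext, comp_assoc. Qed.

Program Definition Forget (M : Category) (T : Monad M) : Functor (EM T) M := {|
  fobj := fun X : EM T => carrier X;
  fmap := fun X Y f => module_hom f
|}.

Record DistributiveLaw (M : Category) (T : Monad M) (G : Functor M M) : Type := {
  dlaw :> NatTrans (T ∙ G) (G ∙ T);
  dlaw_mu : forall X,
    dlaw X ∘ mu T (G X) = fmap G (mu T X) ∘ dlaw (T X) ∘ fmap T (dlaw X);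
  dlaw_eta : forall X, dlaw X ∘ eta T (G X) = fmap G (eta T X)
}.

Record ComonadDistributiveLaw (M : Category) (T : Monad M) (G : Comonad M) :
    Type := {
  cdlaw :> DistributiveLaw T G;
  cdlaw_delta : forall X,
    delta G (T X) ∘ cdlaw X
    = fmap G (cdlaw X) ∘ cdlaw (G X) ∘ fmap T (delta G X);
  cdlaw_epsilon : forall X,
    epsilon G (T X) ∘ cdlaw X = fmap T (epsilon G X)
}.

Record DistrObj (M : Category) (G : Functor M M) : Type := {
  distr_monad : Monad M;
  distr_law : DistributiveLaw distr_monad G
}.

Record DistrHom (M : Category) (G : Functor M M) (D D' : DistrObj G) : Type := {
  distr_hom :> NatTrans (distr_monad D) (distr_monad D');
  distr_hom_mu : forall X,
    distr_hom X ∘ mu (distr_monad D) X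
    = mu (distr_monad D') X ∘ distr_hom (distr_monad D' X)
      ∘ fmap (distr_monad D) (distr_hom X);
  distr_hom_eta : forall X,
    distr_hom X ∘ eta (distr_monad D) X = eta (distr_monad D') X;
  distr_hom_law : forall X,
    distr_law D' X ∘ distr_hom (G X) = fmap G (distr_hom X) ∘ distr_law D X
}.

Lemma DistrHom_ext (M : Category) (G : Functor M M) (D D' : DistrObj G)
    (a b : DistrHom D D') :
  component (distr_hom a) = component (distr_hom b) -> a = b.
Proof.
  destruct a as [[a na] a1 a2 a3], b as [[b nb] b1 b2 b3]; simpl; intros E.
  destruct E.
  destruct (proof_irrelevance _ na nb), (proof_irrelevance _ a1 b1).
  destruct (proof_irrelevance _ a2 b2), (proof_irrelevance _ a3 b3).
  reflexivity.
Qed.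

Program Definition Distr (M : Category) (G : Functor M M) : Category := {|
  Obj := DistrObj G;
  Hom := @DistrHom M G;
  idm := fun D =>
    {| distr_hom := {| component := fun X => idm (distr_monad D X) |} |};
  comp := fun D D' D'' b a =>
    {| distr_hom := {| component := fun X => distr_hom b X ∘ distr_hom a X |} |}
|}.
Next Obligation. rewrite comp_id_l, comp_id_r; reflexivity. Qed.
Next Obligation. rewrite fmap_id, comp_id_l, !comp_id_r; reflexivity. Qed.
Next Obligation. apply comp_id_l. Qed.
Next Obligation. rewrite fmap_id, comp_id_l, comp_id_r; reflexivity. Qed.
Next Obligation.
  rewrite <- comp_assoc, naturality, comp_assoc, naturality, comp_assoc.
  reflexivity.
Qed.
Next Obligation.
  pose proof (distr_hom_mu a X) as Ea; pose proof (distr_hom_mu b X) as Eb.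
  pose proof (naturality a (b X)) as N; simpl in *.
  rewrite <- comp_assoc, Ea, !comp_assoc, Eb, fmap_comp.
  rewrite <- !comp_assoc; do 2 f_equal.
  rewrite !comp_assoc; f_equal.
  rewrite N; reflexivity.
Qed.
Next Obligation.
  pose proof (distr_hom_eta a X) as Ea; pose proof (distr_hom_eta b X) as Eb.
  simpl in *; rewrite <- comp_assoc, Ea, Eb; reflexivity.
Qed.
Next Obligation.
  pose proof (distr_hom_law a X) as Ea; pose proof (distr_hom_law b X) as Eb.
  simpl in *; rewrite comp_assoc, Eb, <- comp_assoc, Ea, fmap_comp, comp_assoc.
  reflexivity.
Qed.
Next Obligation.
  apply DistrHom_ext, functional_extensionality_dep; intros; apply comp_id_l.
Qed.
Next Obligation.
  apply DistrHom_ext, functional_extensionality_dep; intros; apply comp_id_r.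
Qed.
Next Obligation.
  apply DistrHom_ext, functional_extensionality_dep; intros; apply comp_assoc.
Qed.

Record ComonadDistrObj (M : Category) (G : Comonad M) : Type := {
  cdistr_monad : Monad M;
  cdistr_law : ComonadDistributiveLaw cdistr_monad G
}.

Definition ComonadDistr (M : Category) (G : Comonad M) : Category :=
  Induced (C := Distr G)
    (fun D : ComonadDistrObj G => {| distr_law := cdistr_law D |}).

Record EndoLift (M : Category) (T : Monad M) (G : Functor M M) : Type := {
  lift_functor :> Functor (EM T) (EM T);
  lift_forget : Forget T ∙ lift_functor = G ∙ Forget T
}.

(* In the last two fields the two sides have the same source and target only up
   to [clift_forget]. *)
Record ComonadLift (M : Category) (T : Monad M) (G : Comonad M) : Type := {
  clift_comonad :> Comonad (EM T);
  clift_forget : Forget T ∙ clift_comonad = G ∙ Forget T;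
  clift_delta : forall X : EM T,
    hom_eq (fmap (Forget T) (delta clift_comonad X)) (delta G (Forget T X));
  clift_epsilon : forall X : EM T,
    hom_eq (fmap (Forget T) (epsilon clift_comonad X)) (epsilon G (Forget T X))
}.

Definition endo_of_comonad_lift (M : Category) (T : Monad M) (G : Comonad M)
    (L : ComonadLift T G) : EndoLift T G :=
  {| lift_functor := L; lift_forget := clift_forget L |}.

(* An Eilenberg-Moore category [EM em_monad] with a lift of [G]. *)
Record EMLiftObj (M : Category) (G : Functor M M) : Type := {
  em_monad : Monad M;
  em_lift : EndoLift em_monad G
}.

Record EMLiftHom (M : Category) (G : Functor M M) (L L' : EMLiftObj G) :
    Type := {
  em_functor :> Functor (EM (em_monad L)) (EM (em_monad L'));
  em_functor_forget :
    Forget (em_monad L') ∙ em_functor = Forget (em_monad L);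
  em_functor_lift : em_functor ∙ em_lift L = em_lift L' ∙ em_functor
}.

Lemma EMLiftHom_ext (M : Category) (G : Functor M M) (L L' : EMLiftObj G)
    (H K : EMLiftHom L L') : em_functor H = em_functor K -> H = K.
Proof.
  destruct H as [H h1 h2], K as [K k1 k2]; simpl; intros <-.
  rewrite (proof_irrelevance _ h1 k1), (proof_irrelevance _ h2 k2).
  reflexivity.
Qed.

Program Definition EMLift (M : Category) (G : Functor M M) : Category := {|
  Obj := EMLiftObj G;
  Hom := @EMLiftHom M G;
  idm := fun L => {| em_functor := IdF (EM (em_monad L)) |};
  comp := fun L L' L'' K H => {| em_functor := K ∙ H |}
|}.
Next Obligation. apply CompF_id_r. Qed.
Next Obligation. rewrite CompF_id_l, CompF_id_r; reflexivity. Qed.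
Next Obligation. rewrite CompF_assoc, !em_functor_forget; reflexivity. Qed.
Next Obligation.
  rewrite <- CompF_assoc, em_functor_lift, CompF_assoc, em_functor_lift.
  rewrite <- CompF_assoc; reflexivity.
Qed.
Next Obligation. apply EMLiftHom_ext, CompF_id_l. Qed.
Next Obligation. apply EMLiftHom_ext, CompF_id_r. Qed.
Next Obligation. apply EMLiftHom_ext, CompF_assoc. Qed.

Record ComonadEMLiftObj (M : Category) (G : Comonad M) : Type := {
  cem_monad : Monad M;
  cem_lift : ComonadLift cem_monad G
}.

(* A morphism is only required to intertwine the lifted functors, not the lifted
   comultiplications and counits: these are then preserved, as forgetful functors
   are faithful. *)
Definition ComonadEMLift (M : Category) (G : Comonad M) : Category :=
  Induced (C := EMLift G)
    (fun L : ComonadEMLiftObj G =>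
       {| em_lift := endo_of_comonad_lift (cem_lift L) |}).

(* On objects, the lift sends (X, ν) to (G X, G ν ∘ l_X).  Its values on morphisms
   are then forced by [lift_forget]. *)
Definition lifts_along (M : Category) (T : Monad M) (G : Functor M M)
    (l : DistributiveLaw T G) (Gt : Functor (EM T) (EM T)) : Prop :=
  forall X : EM T,
    hom_eq (action (Gt X)) (fmap G (action X) ∘ l (carrier X)).

(* On objects, the functor sends (X, ν) to (X, ν ∘ α_X). *)
Definition restricts_along (M : Category) (T T' : Monad M) (a : NatTrans T T')
    (H : Functor (EM T') (EM T)) : Prop :=
  forall X : EM T', hom_eq (action (H X)) (action X ∘ a (carrier X)).

(* A monad morphism T -> T' induces a functor EM T' -> EM T, hence the opposite
   category in the source. *)
Definition is_canonical (M : Category) (G : Functor M M)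
    (F : Functor (op (Distr G)) (EMLift G)) : Prop :=
  (forall (T : Monad M) (l : DistributiveLaw T G),
     exists Gt : EndoLift T G,
       F {| distr_law := l |} = {| em_lift := Gt |} /\ lifts_along l Gt) /\
  (forall (T T' : Monad M) (l : DistributiveLaw T G) (l' : DistributiveLaw T' G)
     (a : @Hom (Distr G) {| distr_law := l |} {| distr_law := l' |}),
     exists (Gt : EndoLift T G) (Gt' : EndoLift T' G)
       (H : @Hom (EMLift G) {| em_lift := Gt' |} {| em_lift := Gt |}),
       hom_eq (@fmap _ _ F {| distr_law := l' |} {| distr_law := l |} a) H /\
       restricts_along (distr_hom a) (em_functor H)).

Definition is_comonad_canonical (M : Category) (G : Comonad M)
    (F : Functor (op (ComonadDistr G)) (ComonadEMLift G)) : Prop :=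
  (forall (T : Monad M) (l : ComonadDistributiveLaw T G),
     exists Gt : ComonadLift T G,
       F {| cdistr_law := l |} = {| cem_lift := Gt |} /\ lifts_along l Gt) /\
  (forall (T T' : Monad M) (l : ComonadDistributiveLaw T G)
     (l' : ComonadDistributiveLaw T' G)
     (a : @Hom (ComonadDistr G) {| cdistr_law := l |} {| cdistr_law := l' |}),
     exists (Gt : ComonadLift T G) (Gt' : ComonadLift T' G)
       (H : @Hom (ComonadEMLift G) {| cem_lift := Gt' |} {| cem_lift := Gt |}),
       hom_eq (@fmap _ _ F {| cdistr_law := l' |} {| cdistr_law := l |} a) H /\
       restricts_along (distr_hom a) (em_functor H)).

(* Main.v *)
Require Import Defs.
From Stdlib Require Import ProofIrrelevance FunctionalExtensionality.

(** Let T and T' be monads on M and Q an endofunctor of M.  Both halves of the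
    correspondence, on objects and on morphisms, are instances of one bijection:
    functors H from the T'-modules to the T-modules with U H = Q U' correspond to
    natural transformations l : T Q -> Q T' compatible with the multiplications
    and units ([MonadFunctor]).  For T' = T and Q = G these l are the distributive
    laws and the H are the lifts of G; for Q the identity they are the monad
    morphisms T -> T' and the functors commuting with the forgetful functors.

    From l to H, a T'-module (N, ν) goes to (Q N, Q ν ∘ l_N) ([lift]).  From H to
    l, the functor H amounts to a T-action s on Q N for every module N, natural in
    module homomorphisms, and l_X is the value of s on the free module T' X,
    restricted along the unit: l_X = s_{T'X} ∘ T Q η'_X.  Naturality of s along
    the homomorphism ν : T' N -> N shows that s is recovered from l
    ([lift_surj]), and the unit law of T' shows that l is recovered from s
    ([lift_inj]).

    A functor induced by α : T -> T' intertwines the lifts given by l and l' iff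
    the actions Gν ∘ l'_N ∘ α_{GN} and Gν ∘ Gα_N ∘ l_N agree on every T'-module
    N.  Testing on free modules, this is the condition l' ∘ αG = Gα ∘ l on
    morphisms of distributive laws ([intertwining_iff]).

    For a comonad G, forgetful functors being faithful, a lift of δ and ε is
    the property that each δ_N and ε_N is a module homomorphism for the
    lifted actions.  Testing on free modules turns these properties into the
    two additional axioms of a distributive law ([delta_module_hom_iff],
    [epsilon_module_hom_iff]).

    These bijections make the functor to Eilenberg-Moore categories bijective on
    objects and on morphisms, hence an isomorphism
    ([isomorphism_of_bijections]). *)

Set Implicit Arguments.
Unset Strict Implicit.
Unset Printing Implicit Defensive.

(** * Equality of morphisms and functors *)

Lemma hom_eq_source (C : Category) (X Y X' Y' : C) (f : Hom X Y)
    (f' : Hom X' Y') : hom_eq f f' -> X = X'.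
Proof. intros []; reflexivity. Qed.

Lemma hom_eq_target (C : Category) (X Y X' Y' : C) (f : Hom X Y)
    (f' : Hom X' Y') : hom_eq f f' -> Y = Y'.
Proof. intros []; reflexivity. Qed.

(** Uniqueness of identity proofs, here a consequence of proof irrelevance: a
    morphism is determined by its dependent pair with source and target. *)
Lemma eq_of_hom_eq (C : Category) (X Y : C) (f f' : Hom X Y) :
  hom_eq f f' -> f = f'.
Proof.
  intros E.
  pose (p := fun A (g : sigT (fun B : C => Hom A B)) =>
    existT (fun A : C => sigT (fun B : C => Hom A B)) A g).
  assert (E' : p X (existT _ Y f) = p X (existT _ Y f'))
    by (destruct E; reflexivity).
  apply inj_pair2 in E'; apply inj_pair2 in E'; exact E'.
Qed.

Lemma hom_eq_of_eq (C : Category) (X Y : C) (f f' : Hom X Y) :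
  f = f' -> hom_eq f f'.
Proof. intros []; constructor. Qed.

Lemma hom_eq_sym (C : Category) (X Y X' Y' : C) (f : Hom X Y)
    (f' : Hom X' Y') : hom_eq f f' -> hom_eq f' f.
Proof. intros []; constructor. Qed.

Lemma hom_eq_trans (C : Category) (X Y X' Y' X'' Y'' : C) (f : Hom X Y)
    (f' : Hom X' Y') (f'' : Hom X'' Y'') :
  hom_eq f f' -> hom_eq f' f'' -> hom_eq f f''.
Proof. intros E []; exact E. Qed.

Lemma hom_eq_idm (C : Category) (X X' : C) :
  X = X' -> hom_eq (idm X) (idm X').
Proof. intros []; constructor. Qed.

Lemma hom_eq_comp (C : Category) (X Y Z X' Y' Z' : C) (g : Hom Y Z)
    (f : Hom X Y) (g' : Hom Y' Z') (f' : Hom X' Y') :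
  hom_eq g g' -> hom_eq f f' -> hom_eq (g ∘ f) (g' ∘ f').
Proof.
  intros Eg Ef.
  destruct (hom_eq_source Ef), (hom_eq_target Ef), (hom_eq_target Eg).
  rewrite (eq_of_hom_eq Eg), (eq_of_hom_eq Ef); constructor.
Qed.

Lemma functor_ext (C D : Category) (F G : Functor C D) :
  (forall X, F X = G X) ->
  (forall X Y (f : Hom X Y), hom_eq (fmap F f) (fmap G f)) -> F = G.
Proof.
  destruct F as [o m p q], G as [o' m' p' q']; simpl; intros Eo Em.
  apply functional_extensionality in Eo; subst o'.
  assert (E : m = m').
  { apply functional_extensionality_dep; intros X.
    apply functional_extensionality_dep; intros Y.
    apply functional_extensionality; intros f.
    apply eq_of_hom_eq, Em. }
  subst m'; apply functor_irrelevance.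
Qed.

Lemma functor_eq_fmap (C D : Category) (F G : Functor C D) (X Y : C)
    (f : Hom X Y) : F = G -> hom_eq (fmap F f) (fmap G f).
Proof. intros []; constructor. Qed.

Lemma nat_trans_ext (C D : Category) (F G : Functor C D) (a b : NatTrans F G) :
  (forall X, a X = b X) -> a = b.
Proof.
  destruct a as [a na], b as [b nb]; simpl; intros E.
  apply functional_extensionality_dep in E; subst b.
  f_equal; apply proof_irrelevance.
Qed.

(** Surjectivity is given by explicit preimages, so that the inverse functor is
    built without a choice principle.  On a morphism X -> Y, whose source and
    target are F of the preimages only up to equality, the inverse is the unique
    morphism between the preimages that F sends to it up to [hom_eq]. *)
Lemma isomorphism_of_bijections (C D : Category) (F : Functor C D) :
  (forall X Y : C, F X = F Y -> X = Y) ->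
  (forall X : D, {X' : C | F X' = X}) ->
  (forall (X Y : C) (f g : Hom X Y), fmap F f = fmap F g -> f = g) ->
  (forall (X Y : C) (h : Hom (F X) (F Y)), {f : Hom X Y | fmap F f = h}) ->
  is_isomorphism_of_categories F.
Proof.
  intros inj surj faithful full.
  pose (o := fun X => proj1_sig (surj X)).
  assert (Eo : forall X, F (o X) = X) by (intros X; apply (proj2_sig (surj X))).
  assert (lift : forall X Y (h : Hom X Y),
             {f : Hom (o X) (o Y) | hom_eq (fmap F f) h}).
  { intros X Y; generalize (o X) (o Y) (Eo X) (Eo Y).
    intros X' Y' [] [] h; destruct (full _ _ h) as [f E].
    exists f; apply hom_eq_of_eq, E. }
  pose (m := fun X Y (h : Hom X Y) => proj1_sig (lift X Y h)).
  assert (Em : forall X Y (h : Hom X Y), hom_eq (fmap F (m X Y h)) h)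
    by (intros X Y h; apply (proj2_sig (lift X Y h))).
  assert (m_id : forall X, m X X (idm X) = idm (o X)).
  { intros X; apply faithful, eq_of_hom_eq; rewrite fmap_id.
    apply (hom_eq_trans (Em _ _ _)), hom_eq_idm; symmetry; apply Eo. }
  assert (m_comp : forall X Y Z (g : Hom Y Z) (f : Hom X Y),
             m X Z (g ∘ f) = m Y Z g ∘ m X Y f).
  { intros X Y Z g f; apply faithful, eq_of_hom_eq; rewrite fmap_comp.
    apply (hom_eq_trans (Em _ _ _)), hom_eq_sym, hom_eq_comp; apply Em. }
  exists {| fobj := o; fmap := m; fmap_id := m_id; fmap_comp := m_comp |}.
  split; apply functor_ext; simpl; auto.
  (* Generalizing the preimages of F X and F Y allows to identify them with X
     and Y. *)
  intros X Y f.
  generalize (Em _ _ (fmap F f)); generalize (m _ _ (fmap F f)).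
  generalize (inj _ _ (Eo (F X))) (inj _ _ (Eo (F Y))).
  generalize (o (F X)) (o (F Y)).
  intros X' Y' -> -> f' E.
  apply hom_eq_of_eq, faithful, eq_of_hom_eq, E.
Qed.

Lemma comp_square (C : Category) (W X Y Y' Z : C) (g : Hom Y Z) (f : Hom X Y)
    (g' : Hom Y' Z) (f' : Hom X Y') (x : Hom W X) :
  g ∘ f = g' ∘ f' -> g ∘ (f ∘ x) = g' ∘ (f' ∘ x).
Proof. intros E; rewrite !comp_assoc, E; reflexivity. Qed.

Lemma comp_section (C : Category) (X Y Z : C) (g : Hom Y Z) (f : Hom Z Y)
    (x : Hom X Z) : g ∘ f = idm Z -> g ∘ (f ∘ x) = x.
Proof. intros E; rewrite comp_assoc, E; apply comp_id_l. Qed.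

(** * Functors into Eilenberg-Moore categories *)

Section FunctorsIntoModules.
Context (M : Category) (T : Monad M).

Lemma TModule_ext (X : M) (a a' : Hom (T X) X) p q p' q' :
  a = a' -> @Build_TModule M T X a p q = @Build_TModule M T X a' p' q'.
Proof. intros E; subst a'; f_equal; apply proof_irrelevance. Qed.

Lemma action_inj (X : M) (a a' : Hom (T X) X) p q p' q' :
  @Build_TModule M T X a p q = @Build_TModule M T X a' p' q' -> a = a'.
Proof.
  intros E.
  apply (f_equal (fun N : TModule T =>
    existT (fun X : M => Hom (T X) X) (carrier N) (action N))) in E.
  apply inj_pair2 in E; exact E.
Qed.

(** The forgetful functor is faithful, so the values on morphisms are determined
    by the composite with it. *)
Lemma EM_functor_ext (C : Category) (H K : Functor C (EM T)) :
  Forget T ∙ H = Forget T ∙ K -> (forall X, H X = K X) -> H = K.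
Proof.
  intros E Eo; apply functor_ext; [exact Eo|]; intros X Y f.
  generalize (functor_eq_fmap f E); simpl.
  generalize (fmap H f) (fmap K f); rewrite (Eo X), (Eo Y); intros h k Ehk.
  apply hom_eq_of_eq, ModuleHom_ext, eq_of_hom_eq, Ehk.
Qed.

(** A functor H into T-modules over P is a natural T-action s on P.  For P a
    variable, the equation on functors can be eliminated, and s is then the
    family of actions of the modules H X; this removes all transport along that
    equation in what follows. *)
Lemma action_over (C : Category) (P : Functor C M) (H : Functor C (EM T)) :
  Forget T ∙ H = P ->
  {s : forall X : C, Hom (T (P X)) (P X) |
    (forall X, exists p q, H X = @Build_TModule M T (P X) (s X) p q) /\
    (forall X Y (f : Hom X Y), fmap P f ∘ s X = s Y ∘ fmap T (fmap P f))}.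
Proof.
  intros <-; exists (fun X => action (H X)); split.
  - intros X; simpl; destruct (H X) as [N a p q]; exists p, q; reflexivity.
  - intros X Y f; exact (module_hom_action (fmap H f)).
Qed.

Definition free_module (X : M) : TModule T :=
  {| carrier := T X; action := mu T X;
     action_mu := eq_sym (mu_assoc T X); action_eta := mu_eta_l T X |}.

Definition free_hom (X Y : M) (f : Hom X Y) :
    ModuleHom (free_module X) (free_module Y) :=
  @Build_ModuleHom M T (free_module X) (free_module Y) (fmap T f)
    (eq_sym (naturality (mu T) f)).

Definition counit_hom (N : TModule T) : ModuleHom (free_module N) N :=
  @Build_ModuleHom M T (free_module N) N (action N) (action_mu N).

End FunctorsIntoModules.

(** * Lifting functors to modules *)

(** The morphisms of monads (M, T') -> (M, T) of the formal theory of monads,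
    over a functor Q.  A common generalization of distributive laws (T' = T) and
    of monad morphisms (Q the identity). *)
Record MonadFunctor (M : Category) (T T' : Monad M) (Q : Functor M M) : Type := {
  mlaw :> NatTrans (T ∙ Q) (Q ∙ T');
  mlaw_mu : forall X,
    mlaw X ∘ mu T (Q X) = fmap Q (mu T' X) ∘ mlaw (T' X) ∘ fmap T (mlaw X);
  mlaw_eta : forall X, mlaw X ∘ eta T (Q X) = fmap Q (eta T' X)
}.

Section Lifts.
Context (M : Category) (T T' : Monad M) (Q : Functor M M).

Program Definition lift_module (l : MonadFunctor T T' Q) (N : TModule T') :
    TModule T :=
  {| carrier := Q N; action := fmap Q (action N) ∘ l (carrier N) |}.
Next Obligation.
  pose proof (naturality l (action N)) as n; simpl in n.
  pose proof (mlaw_mu l (carrier N)) as m; simpl in m.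
  rewrite fmap_comp, <- !comp_assoc, m, <- !comp_assoc.
  pose proof (action_mu N) as a; simpl in a.
  rewrite (comp_square _ n), !comp_assoc, <- !fmap_comp, a; reflexivity.
Qed.
Next Obligation.
  pose proof (mlaw_eta l (carrier N)) as e; simpl in e.
  pose proof (action_eta N) as a; simpl in a.
  rewrite <- comp_assoc, e, <- fmap_comp, a; apply fmap_id.
Qed.

Program Definition lift (l : MonadFunctor T T' Q) : Functor (EM T') (EM T) :=
  {| fobj := fun N : EM T' => lift_module l N : EM T;
     fmap := fun N N' f => {| module_hom := fmap Q (module_hom f) |} |}.
Next Obligation.
  pose proof (naturality l (module_hom f)) as n; simpl in n.
  rewrite <- !comp_assoc, n, !comp_assoc, <- !fmap_comp, module_hom_action.
  reflexivity.
Qed.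
Next Obligation. apply ModuleHom_ext, fmap_id. Qed.
Next Obligation. apply ModuleHom_ext, fmap_comp. Qed.

Lemma lift_over (l : MonadFunctor T T' Q) : Forget T ∙ lift l = Q ∙ Forget T'.
Proof. apply functor_irrelevance. Qed.

(** The law l is the lifted action on the free module T' X, restricted along the
    unit of T': by naturality the unit passes through l, where it cancels μ'. *)
Lemma law_from_free_module (l : NatTrans (T ∙ Q) (Q ∙ T')) (X : M) :
  fmap Q (mu T' X) ∘ l (T' X) ∘ fmap T (fmap Q (eta T' X)) = l X.
Proof.
  pose proof (naturality l (eta T' X)) as n; simpl in *.
  rewrite <- comp_assoc, n; apply comp_section.
  pose proof (mu_eta_r T' X) as u; simpl in u.
  rewrite <- fmap_comp, u; apply fmap_id.
Qed.

Lemma lift_inj (l l' : MonadFunctor T T' Q) :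
  lift l = lift l' -> forall X, l X = l' X.
Proof.
  intros E X.
  apply (f_equal (fun H : Functor (EM T') (EM T) => H (free_module T' X))) in E.
  apply action_inj in E.
  rewrite <- (law_from_free_module l), <- (law_from_free_module l').
  simpl in *; rewrite E; reflexivity.
Qed.

(** H is given by a natural action s, and l is s on free modules restricted along
    the unit.  The action ν : T' N -> N is a homomorphism from the free module, so
    s_N ∘ T Q ν = Q ν ∘ s_{T'N}; restricting along the unit gives
    s_N = Q ν ∘ l_N.  The law for μ follows from this for N = T' X and from
    associativity of s. *)
Lemma lift_surj (H : Functor (EM T') (EM T)) :
  Forget T ∙ H = Q ∙ Forget T' -> {l : MonadFunctor T T' Q | lift l = H}.
Proof.
  intros E; destruct (action_over E) as [s [Es ns]]; simpl in *.
  pose (l := fun X : M => s (free_module T' X) ∘ fmap T (fmap Q (eta T' X))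
    : Hom (T (Q X)) (Q (T' X))).
  assert (s_mu : forall N, s N ∘ mu T (Q N) = s N ∘ fmap T (s N)).
  { intros N; destruct (Es N) as [p _]; exact p. }
  assert (s_eta : forall N, s N ∘ eta T (Q N) = idm _).
  { intros N; destruct (Es N) as [_ [q _]]; exact q. }
  assert (l_nat : forall X Y (f : Hom X Y),
             l Y ∘ fmap T (fmap Q f) = fmap Q (fmap T' f) ∘ l X).
  { intros X Y f; unfold l.
    pose proof (ns _ _ (free_hom T' f)) as n; simpl in n.
    pose proof (naturality (eta T') f) as e; simpl in e.
    rewrite (comp_square _ n), <- !comp_assoc, <- !fmap_comp, e; reflexivity. }
  assert (l_action : forall N : TModule T', fmap Q (action N) ∘ l N = s N).
  { intros N; unfold l.
    pose proof (ns _ _ (counit_hom N)) as n; simpl in n.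
    rewrite (comp_square _ n), <- !fmap_comp, action_eta, !fmap_id.
    apply comp_id_r. }
  assert (l_mu : forall X, l X ∘ mu T (Q X)
             = fmap Q (mu T' X) ∘ l (T' X) ∘ fmap T (l X)).
  { intros X.
    pose proof (l_action (free_module T' X)) as la.
    pose proof (s_mu (free_module T' X)) as sm.
    pose proof (naturality (mu T) (fmap Q (eta T' X))) as n.
    simpl in *; rewrite la; unfold l; simpl.
    rewrite <- comp_assoc, <- n, (comp_square _ sm), fmap_comp.
    reflexivity. }
  assert (l_eta : forall X, l X ∘ eta T (Q X) = fmap Q (eta T' X)).
  { intros X; unfold l.
    pose proof (naturality (eta T) (fmap Q (eta T' X))) as n; simpl in *.
    rewrite <- comp_assoc, <- n; apply comp_section.
    apply (s_eta (free_module T' X)). }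
  exists {| mlaw := @Build_NatTrans _ _ (T ∙ Q) (Q ∙ T') l l_nat;
            mlaw_mu := l_mu; mlaw_eta := l_eta |}.
  apply EM_functor_ext.
  - rewrite E; apply lift_over.
  - intros N; destruct (Es N) as [p [q ->]]; apply TModule_ext, l_action.
Qed.

End Lifts.

(** * Distributive laws and lifts of an endofunctor *)

Section Endofunctor.
Context (M : Category) (G : Functor M M).

Definition monad_functor_of_law (T : Monad M) (l : DistributiveLaw T G) :
    MonadFunctor T T G :=
  {| mlaw := l; mlaw_mu := dlaw_mu l; mlaw_eta := dlaw_eta l |}.

Definition endo_lift (T : Monad M) (l : DistributiveLaw T G) : EndoLift T G :=
  {| lift_functor := lift (monad_functor_of_law l);
     lift_forget := lift_over (monad_functor_of_law l) |}.

Lemma law_ext (T : Monad M) (l l' : DistributiveLaw T G) :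
  (forall X, l X = l' X) -> l = l'.
Proof.
  destruct l as [l p q], l' as [l' p' q']; simpl; intros E.
  assert (l = l') by (apply nat_trans_ext, E).
  subst l'; f_equal; apply proof_irrelevance.
Qed.

Lemma endo_lift_inj (T : Monad M) (l l' : DistributiveLaw T G) :
  endo_lift l = endo_lift l' -> l = l'.
Proof.
  intros E; apply law_ext, (lift_inj (l := monad_functor_of_law l)
    (l' := monad_functor_of_law l')), (f_equal (@lift_functor M T G) E).
Qed.

Lemma endo_lift_surj (T : Monad M) (L : EndoLift T G) :
  {l : DistributiveLaw T G | endo_lift l = L}.
Proof.
  destruct L as [H E]; destruct (lift_surj E) as [l El].
  exists {| dlaw := l; dlaw_mu := mlaw_mu l; dlaw_eta := mlaw_eta l |}.
  destruct l as [l p q], El; unfold endo_lift, monad_functor_of_law; simpl.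
  f_equal; apply proof_irrelevance.
Qed.

Definition em_object (D : DistrObj G) : EMLiftObj G :=
  {| em_lift := endo_lift (distr_law D) |}.

Lemma em_object_inj (D D' : DistrObj G) : em_object D = em_object D' -> D = D'.
Proof.
  destruct D as [T l], D' as [T' l']; unfold em_object; simpl; intros E.
  pose proof (f_equal (@em_monad M G) E) as ET; simpl in ET; subst T'.
  apply (f_equal (fun L : EMLiftObj G =>
    existT (fun T => EndoLift T G) (em_monad L) (em_lift L))), inj_pair2 in E.
  apply endo_lift_inj in E; subst l'; reflexivity.
Qed.

Lemma em_object_surj (L : EMLiftObj G) : {D : DistrObj G | em_object D = L}.
Proof.
  destruct L as [T L], (endo_lift_surj L) as [l E].
  exists {| distr_law := l |}; destruct E; reflexivity.
Qed.

Definition monad_functor_of_hom (D D' : DistrObj G) (a : DistrHom D D') :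
    MonadFunctor (distr_monad D) (distr_monad D') (IdF M) :=
  {| mlaw := @Build_NatTrans _ _ (distr_monad D ∙ IdF M)
               (IdF M ∙ distr_monad D') a (naturality a);
     mlaw_mu := distr_hom_mu a; mlaw_eta := distr_hom_eta a |}.

(** Both composites lie over G U', so they agree iff they produce the same
    actions, Gν ∘ l'_N ∘ α_{GN} and Gν ∘ Gα_N ∘ l_N.  For free N, restriction
    along the unit recovers the condition on l, l' and α. *)
Lemma intertwining_iff (D D' : DistrObj G)
    (a : MonadFunctor (distr_monad D) (distr_monad D') (IdF M)) :
  lift a ∙ endo_lift (distr_law D') = endo_lift (distr_law D) ∙ lift a <->
  forall X, distr_law D' X ∘ a (G X) = fmap G (a X) ∘ distr_law D X.
Proof.
  destruct D as [T l], D' as [T' l']; simpl in *; split; intros E.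
  - intros X.
    apply (f_equal (fun H : Functor (EM T') (EM T) => H (free_module T' X))) in E.
    apply action_inj in E.
    pose proof (naturality a (fmap G (eta T' X))) as na.
    pose proof (naturality l (eta T' X)) as nl.
    pose proof (law_from_free_module l' X) as fl.
    pose proof (law_from_free_module a X) as fa.
    simpl in *; rewrite <- fl, <- comp_assoc, <- na, comp_assoc, E.
    rewrite <- comp_assoc, nl, comp_assoc, <- fmap_comp, fa; reflexivity.
  - apply EM_functor_ext.
    + transitivity (G ∙ Forget T'); [|symmetry]; apply functor_irrelevance.
    + intros N; apply TModule_ext; simpl.
      rewrite fmap_comp, <- !comp_assoc, E; reflexivity.
Qed.

Lemma restriction_over (D D' : DistrObj G)
    (a : MonadFunctor (distr_monad D) (distr_monad D') (IdF M)) :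
  Forget (distr_monad D) ∙ lift a = Forget (distr_monad D').
Proof. rewrite lift_over; apply CompF_id_l. Qed.

Definition restriction (D D' : DistrObj G) (a : DistrHom D D') :
    EMLiftHom (em_object D') (em_object D) :=
  @Build_EMLiftHom M G (em_object D') (em_object D)
    (lift (monad_functor_of_hom a)) (restriction_over (monad_functor_of_hom a))
    (proj2 (intertwining_iff (monad_functor_of_hom a)) (distr_hom_law a)).

Lemma restriction_inj (D D' : DistrObj G) (a b : DistrHom D D') :
  restriction a = restriction b -> a = b.
Proof.
  intros E; apply DistrHom_ext, functional_extensionality_dep.
  apply (lift_inj (l := monad_functor_of_hom a) (l' := monad_functor_of_hom b)).
  exact (f_equal (fun H : EMLiftHom _ _ => em_functor H) E).
Qed.

Lemma restriction_surj (D D' : DistrObj G)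
    (H : EMLiftHom (em_object D') (em_object D)) :
  {a : DistrHom D D' | restriction a = H}.
Proof.
  destruct H as [H over intertwine]; simpl in *.
  destruct (lift_surj (Q := IdF M) (H := H)) as [l El].
  { rewrite CompF_id_l; exact over. }
  subst H.
  exists {| distr_hom := @Build_NatTrans _ _ (distr_monad D) (distr_monad D') l
                           (naturality l);
            distr_hom_mu := mlaw_mu l; distr_hom_eta := mlaw_eta l;
            distr_hom_law := proj1 (intertwining_iff l) intertwine |}.
  apply EMLiftHom_ext; simpl; f_equal.
  destruct l as [[l n] p q]; reflexivity.
Qed.

Program Definition em_category_functor : Functor (op (Distr G)) (EMLift G) :=
  {| fobj := em_object : op (Distr G) -> EMLift G;
     fmap := fun D D' a => restriction a |}.
Next Obligation.
  apply EMLiftHom_ext, EM_functor_ext; simpl.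
  - rewrite lift_over, CompF_id_l, CompF_id_r; reflexivity.
  - intros [N a p q]; apply TModule_ext, comp_id_r.
Qed.
Next Obligation.
  apply EMLiftHom_ext, EM_functor_ext; simpl.
  - rewrite CompF_assoc, !restriction_over; reflexivity.
  - intros N; apply TModule_ext, comp_assoc.
Qed.

Lemma em_category_functor_canonical : is_canonical em_category_functor.
Proof.
  split.
  - intros T l; exists (endo_lift l); split; [reflexivity|].
    intros X; constructor.
  - intros T T' l l' a; exists (endo_lift l), (endo_lift l'), (restriction a).
    split; [constructor|]; intros X; constructor.
Qed.

Lemma em_category_functor_iso : is_isomorphism_of_categories em_category_functor.
Proof.
  apply isomorphism_of_bijections.
  - exact em_object_inj.
  - exact em_object_surj.
  - intros D' D; apply restriction_inj.
  - intros D' D; apply restriction_surj.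
Qed.

End Endofunctor.

(** * Distributive laws and lifts of a comonad *)

Section ComonadCase.
Context (M : Category) (G : Comonad M).

(** Naturality of δ rewrites δ_N ∘ Gν ∘ l_N as GGν ∘ δ_{TN} ∘ l_N, and the other
    side is GGν ∘ G l_N ∘ l_{GN} ∘ T δ_N; so the axiom implies that δ_N is a
    homomorphism.  For the converse, restrict the case N = T X along the unit. *)
Lemma delta_module_hom_iff (T : Monad M) (l : DistributiveLaw T G) :
  (forall N : TModule T,
     delta G N ∘ action (endo_lift l N)
     = action (endo_lift l (endo_lift l N)) ∘ fmap T (delta G N)) <->
  (forall X, delta G (T X) ∘ l X
             = fmap G (l X) ∘ l (G X) ∘ fmap T (delta G X)).
Proof.
  simpl; split; intros E.
  - intros X; pose proof (E (free_module T X)) as EX; simpl in EX.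
    pose proof (law_from_free_module l X) as f.
    pose proof (naturality (delta G) (eta T X)) as nd; simpl in nd.
    pose proof (naturality l (fmap G (eta T X))) as nl; simpl in nl.
    etransitivity; [apply f_equal, eq_sym, f|].
    simpl in *; rewrite comp_assoc, EX, <- !comp_assoc, <- fmap_comp.
    rewrite nd, (fmap_comp T), (comp_square _ nl), !comp_assoc, <- !fmap_comp.
    rewrite f; reflexivity.
  - intros N; pose proof (naturality (delta G) (action N)) as nd; simpl in nd.
    rewrite (comp_square _ nd), E, !fmap_comp, !comp_assoc; reflexivity.
Qed.

Lemma epsilon_module_hom_iff (T : Monad M) (l : DistributiveLaw T G) :
  (forall N : TModule T,
     epsilon G N ∘ action (endo_lift l N) = action N ∘ fmap T (epsilon G N)) <->
  (forall X, epsilon G (T X) ∘ l X = fmap T (epsilon G X)).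
Proof.
  simpl; split; intros E.
  - intros X; pose proof (E (free_module T X)) as EX; simpl in EX.
    pose proof (naturality (epsilon G) (eta T X)) as ne; simpl in ne.
    rewrite <- (law_from_free_module l X); simpl.
    rewrite comp_assoc, EX, <- comp_assoc.
    rewrite <- fmap_comp, ne, (fmap_comp T); apply comp_section, mu_eta_r.
  - intros N; pose proof (naturality (epsilon G) (action N)) as ne; simpl in ne.
    rewrite (comp_square _ ne), E; reflexivity.
Qed.

Section ComonadOnModules.
Context (T : Monad M) (l : ComonadDistributiveLaw T G).

Program Definition lifted_delta :
    NatTrans (endo_lift l) (endo_lift l ∙ endo_lift l) :=
  {| component := fun N : EM T => {| module_hom := delta G (carrier N) |} |}.
Next Obligation. exact (proj2 (delta_module_hom_iff l) (cdlaw_delta l) N). Qed.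
Next Obligation. apply ModuleHom_ext, (naturality (delta G)). Qed.

Program Definition lifted_epsilon : NatTrans (endo_lift l) (IdF (EM T)) :=
  {| component := fun N : EM T => {| module_hom := epsilon G (carrier N) |} |}.
Next Obligation.
  exact (proj2 (epsilon_module_hom_iff l) (cdlaw_epsilon l) N).
Qed.
Next Obligation. apply ModuleHom_ext, (naturality (epsilon G)). Qed.

Program Definition lifted_comonad : Comonad (EM T) :=
  {| comonad_functor := endo_lift l;
     delta := lifted_delta; epsilon := lifted_epsilon |}.
Next Obligation. apply ModuleHom_ext, (delta_coassoc G). Qed.
Next Obligation. apply ModuleHom_ext, (delta_epsilon_l G). Qed.
Next Obligation. apply ModuleHom_ext, (delta_epsilon_r G). Qed.

Definition comonad_lift : ComonadLift T G :=
  {| clift_comonad := lifted_comonad;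
     clift_forget := lift_forget (endo_lift l);
     clift_delta := fun N => hom_eq_refl _;
     clift_epsilon := fun N => hom_eq_refl _ |}.

End ComonadOnModules.

(** The components of the lifted δ and ε have prescribed underlying morphisms. *)
Lemma comonad_lift_determined (T : Monad M) (L L' : ComonadLift T G) :
  comonad_functor L = comonad_functor L' -> L = L'.
Proof.
  destruct L as [[F d e c cl cr] o Ed Ee], L' as [[F' d' e' c' cl' cr'] o' Ed' Ee'].
  simpl in *; intros EF; subst F'.
  assert (d = d').
  { apply nat_trans_ext; intros N; apply ModuleHom_ext, eq_of_hom_eq.
    exact (hom_eq_trans (Ed N) (hom_eq_sym (Ed' N))). }
  assert (e = e').
  { apply nat_trans_ext; intros N; apply ModuleHom_ext, eq_of_hom_eq.
    exact (hom_eq_trans (Ee N) (hom_eq_sym (Ee' N))). }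
  subst d' e'.
  destruct (proof_irrelevance _ c c'), (proof_irrelevance _ cl cl').
  destruct (proof_irrelevance _ cr cr').
  f_equal; apply proof_irrelevance.
Qed.

Lemma comonad_lift_surj (T : Monad M) (L : ComonadLift T G) :
  {l : ComonadDistributiveLaw T G | comonad_lift l = L}.
Proof.
  destruct (endo_lift_surj (endo_of_comonad_lift L)) as [l El].
  apply (f_equal (@lift_functor M T G)) in El; simpl in El.
  assert (Ld : forall X, delta G (T X) ∘ l X
             = fmap G (l X) ∘ l (G X) ∘ fmap T (delta G X)).
  { apply delta_module_hom_iff; intros N; destruct L as [[F d] o Ed Ee].
    simpl in *; subst F.
    pose proof (module_hom_action (d N)) as E.
    pose proof (eq_of_hom_eq (Ed N)) as EN.
    simpl in *; rewrite EN in E; exact E. }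
  assert (Le : forall X, epsilon G (T X) ∘ l X = fmap T (epsilon G X)).
  { apply epsilon_module_hom_iff; intros N; destruct L as [[F d e] o Ed Ee].
    simpl in *; subst F.
    pose proof (module_hom_action (e N)) as E.
    pose proof (eq_of_hom_eq (Ee N)) as EN.
    simpl in *; rewrite EN in E; exact E. }
  exists {| cdlaw := l; cdlaw_delta := Ld; cdlaw_epsilon := Le |}.
  apply comonad_lift_determined, El.
Qed.

Definition comonad_em_object (D : ComonadDistrObj G) : ComonadEMLiftObj G :=
  {| cem_lift := comonad_lift (cdistr_law D) |}.

Lemma comonad_em_object_inj (D D' : ComonadDistrObj G) :
  comonad_em_object D = comonad_em_object D' -> D = D'.
Proof.
  intros E.
  apply (f_equal (fun L : ComonadEMLiftObj G =>
    {| em_lift := endo_of_comonad_lift (cem_lift L) |})) in E.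
  apply (@em_object_inj M G {| distr_law := cdistr_law D |}
    {| distr_law := cdistr_law D' |}) in E.
  destruct D as [T [l p q]], D' as [T' [l' p' q']]; simpl in E.
  pose proof (f_equal (@distr_monad M G) E) as ET; simpl in ET; subst T'.
  apply (f_equal (fun D : DistrObj G =>
    existT (fun T => DistributiveLaw T G) (distr_monad D) (distr_law D))) in E.
  apply inj_pair2 in E; simpl in E; subst l'.
  do 2 f_equal; apply proof_irrelevance.
Qed.

Lemma comonad_em_object_surj (L : ComonadEMLiftObj G) :
  {D : ComonadDistrObj G | comonad_em_object D = L}.
Proof.
  destruct L as [T L], (comonad_lift_surj L) as [l E].
  exists {| cdistr_law := l |}; destruct E; reflexivity.
Qed.

(** The morphisms of both categories, and so the action on them, are those of the
    endofunctor case. *)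
Definition comonad_em_category_functor :
    Functor (op (ComonadDistr G)) (ComonadEMLift G) :=
  {| fobj := comonad_em_object : op (ComonadDistr G) -> ComonadEMLift G;
     fmap := fun D D' a => @restriction M G {| distr_law := cdistr_law D' |}
                             {| distr_law := cdistr_law D |} a;
     fmap_id := fun D =>
       fmap_id (em_category_functor G) {| distr_law := cdistr_law D |};
     fmap_comp := fun D D' D'' b a =>
       @fmap_comp _ _ (em_category_functor G) {| distr_law := cdistr_law D |}
         {| distr_law := cdistr_law D' |} {| distr_law := cdistr_law D'' |} b a
  |}.

Lemma comonad_em_category_functor_canonical :
  is_comonad_canonical comonad_em_category_functor.
Proof.
  split.
  - intros T l; exists (comonad_lift l); split; [reflexivity|].
    intros X; constructor.
  - intros T T' l l' a.
    exists (comonad_lift l), (comonad_lift l'), (restriction a).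
    split; [constructor|]; intros X; constructor.
Qed.

Lemma comonad_em_category_functor_iso :
  is_isomorphism_of_categories comonad_em_category_functor.
Proof.
  apply isomorphism_of_bijections.
  - exact comonad_em_object_inj.
  - exact comonad_em_object_surj.
  - intros D' D; exact (@restriction_inj M G {| distr_law := cdistr_law D |}
      {| distr_law := cdistr_law D' |}).
  - intros D' D; exact (@restriction_surj M G {| distr_law := cdistr_law D |}
      {| distr_law := cdistr_law D' |}).
Qed.

End ComonadCase.

Theorem mainTheorem8 (M : Category) :
  (forall G : Functor M M,
     exists F : Functor (op (Distr G)) (EMLift G),
       is_canonical F /\ is_isomorphism_of_categories F) /\
  (forall G : Comonad M,
     exists F : Functor (op (ComonadDistr G)) (ComonadEMLift G),
       is_comonad_canonical F /\ is_isomorphism_of_categories F).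
Proof.
  split; intros G.
  - exists (em_category_functor G); split.
    + apply em_category_functor_canonical.
    + apply em_category_functor_iso.
  - exists (comonad_em_category_functor G); split.
    + apply comonad_em_category_functor_canonical.
    + apply comonad_em_category_functor_iso.
Qed.
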